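(* There exist real Banach spaces $X$ and $Y$ and a bijection $U\colon X\to Y$ such that \[ \|U(p)-U(q)\|_{Y}=\|p-q\|_{X} \] for every $x\in X$ and every $p,q\in B_X(x,1/4)$, where $B_X(x,1/4)=\{z\in X\mid \|z-x\|_X\le 1/4\}$, while $U$ is not a global isometry, i.e. there are $p,q\in X$ with $\|U(p)-U(q)\|_Y\neq\|p-q\|_X$.
   Context: All Banach spaces are real. The bijection $U$ is a map of sets and is not assumed to be linear. *)

(* Defs.v *)
From HB Require Import structures.
From mathcomp Require Import all_boot all_order all_algebra.
From mathcomp Require Import all_classical all_reals all_analysis.

Set Implicit Arguments.
Unset Strict Implicit.
Unset Printing Implicit Defensive.

Import Order.TTheory GRing.Theory Num.Theory.
Import numFieldNormedType.Exports.

Local Open Scope classical_set_scope.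
Local Open Scope ring_scope.

(* Defined by the norm inequality; the library's [closed_ball] is instead the
   closure of the open ball. *)
Definition cball (R : realType) (X : normedModType R) (x : X) (r : R) : set X :=
  [set z | `|z - x| <= r].

(* Main.v *)
Require Import Defs.
From HB Require Import structures.
From mathcomp Require Import all_boot all_order all_algebra.
From mathcomp Require Import all_classical all_reals all_analysis.
From mathcomp Require Import ring lra.
Import Order.TTheory GRing.Theory Num.Theory.
Import numFieldNormedType.Exports.
Local Open Scope classical_set_scope.
Local Open Scope ring_scope.

(* Let X be a large Banach space and consider functions f on X modulo
   constants; evaluations f |-> f x - f 0 span the Lipschitz-free space of X, and
   a Banach space Y is obtained by restricting them to a set of 1-Lipschitz test
   functions. Evaluation U : X -> Y is 1-Lipschitz, and it preserves the distances
   at most 1/2 as soon as the test functions norm the close pairs of points. We take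
   as tests the 1-Lipschitz f satisfying f (c t) - f 0 = m_t f at points c t that
   are far apart and far from 0, where m_t runs through elements of the
   Lipschitz-free space; this constraint says U (c t) = m_t in Y. If |c t| is large
   compared with the norm of m_t, a local 1-Lipschitz function can be corrected by
   spikes of small slope around the centers so that the constraints hold, and these
   spikes are not felt near the given pair of points. Hence U stays isometric at
   small scale while it shrinks |c t - 0|.
   Every element of Y has a unique normal form in the Lipschitz-free space, namely
   the representative killing all sums of spikes. So U is bijective if the m_t with
   t used are exactly the elements in normal form that are not the normal form of
   U x for a non-center x. The circularity is broken by indexing the
   coordinates of X by well-founded countably branching trees: m_t only involves
   points supported on the children of t, so t can be declared used or not by
   recursion. *)

Set Implicit Arguments.
Unset Strict Implicit.
Unset Printing Implicit Defensive.

(** * Banach spaces of bounded functions *)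

(** Closed subspaces of the bounded functions on [T]. Source and target are both of this form, so
    completeness is proved once. *)
Record bfspace (R : realType) (T : Type) := BFSpace {
  bfmem :> (T -> R) -> Prop;
  bfmem0 : bfmem (fun=> 0);
  bfmem_lin : forall a f g, bfmem f -> bfmem g ->
    bfmem (fun t => a * f t + g t);
  bfmem_bnd : forall f, bfmem f -> exists M, forall t, `|f t| <= M;
  bfmem_closed : forall f,
    (forall e, 0 < e -> exists2 g, bfmem g & forall t, `|f t - g t| <= e) ->
    bfmem f
}.

Record bfelt (R : realType) (T : Type) (V : bfspace R T) :=
  BFElt { bffun :> T -> R; bffunP : V bffun }.

Section BoundedFunctions.
Context {R : realType} {T : Type} (V : bfspace R T).
Implicit Types f g : bfelt V.

Lemma bfeltP f g : (forall t, f t = g t) -> f = g.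
Proof.
case: f g => f fP [g gP] /= fg.
have fg' : f = g by apply/funext.
by subst g; congr BFElt; exact: Prop_irrelevance.
Qed.

HB.instance Definition _ := gen_eqMixin (bfelt V).
HB.instance Definition _ := gen_choiceMixin (bfelt V).

Definition bfzero : bfelt V := BFElt (bfmem0 V).

Lemma bfadd_subproof f g : V (fun t => f t + g t).
Proof.
have := bfmem_lin 1 (bffunP f) (bffunP g).
by congr (bfmem V _); apply/funext => t; rewrite mul1r.
Qed.
Definition bfadd f g : bfelt V := BFElt (bfadd_subproof f g).

Lemma bfscale_subproof a f : V (fun t => a * f t).
Proof.
have := bfmem_lin a (bffunP f) (bfmem0 V).
by congr (bfmem V _); apply/funext => t; rewrite addr0.
Qed.
Definition bfscale a f : bfelt V := BFElt (bfscale_subproof a f).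

Definition bfopp f := bfscale (-1) f.

Fact bfaddA : associative bfadd.
Proof. by move=> f g h; apply: bfeltP => t /=; rewrite addrA. Qed.
Fact bfaddC : commutative bfadd.
Proof. by move=> f g; apply: bfeltP => t /=; rewrite addrC. Qed.
Fact bfadd0 : left_id bfzero bfadd.
Proof. by move=> f; apply: bfeltP => t /=; rewrite add0r. Qed.
Fact bfaddN : left_inverse bfzero bfopp bfadd.
Proof. by move=> f; apply: bfeltP => t /=; rewrite mulN1r addNr. Qed.

HB.instance Definition _ :=
  GRing.isZmodule.Build (bfelt V) bfaddA bfaddC bfadd0 bfaddN.

Fact bfscaleA a b f : bfscale a (bfscale b f) = bfscale (a * b) f.
Proof. by apply: bfeltP => t /=; rewrite mulrA. Qed.
Fact bfscale1 : left_id 1 bfscale.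
Proof. by move=> f; apply: bfeltP => t /=; rewrite mul1r. Qed.
Fact bfscaleDr : right_distributive bfscale +%R.
Proof. by move=> a f g; apply: bfeltP => t /=; rewrite mulrDr. Qed.
Fact bfscaleDl f : {morph bfscale^~ f : a b / a + b}.
Proof. by move=> a b; apply: bfeltP => t /=; rewrite mulrDl. Qed.

HB.instance Definition _ := GRing.Zmodule_isLmodule.Build R (bfelt V)
  bfscaleA bfscale1 bfscaleDr bfscaleDl.

(** For empty [T] the [sup] takes its default value 0, which is the right norm. *)
Definition bfnorm f : R := sup (range (fun t => `|f t|)).

Lemma bfnorm_ub f t : `|f t| <= bfnorm f.
Proof.
apply: ub_le_sup; last by exists t.
have [M fM] := bfmem_bnd (bffunP f).
by exists M => _ [u _ <-].
Qed.

Lemma bfnorm_le f M : 0 <= M -> (forall t, `|f t| <= M) -> bfnorm f <= M.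
Proof.
move=> M0 fM; have [/set0P ne|/negPn/eqP e] := boolP (range (fun t => `|f t|) != set0).
  by apply: ge_sup => // _ [t _ <-].
by rewrite /bfnorm e sup0.
Qed.

Lemma bfnorm_ge0 f : 0 <= bfnorm f.
Proof.
have [/set0P[_ [t _ _]]|/negPn/eqP e] := boolP (range (fun t => `|f t|) != set0).
  exact: le_trans (bfnorm_ub f t).
by rewrite /bfnorm e sup0.
Qed.

Fact bfnormD f g : bfnorm (f + g) <= bfnorm f + bfnorm g.
Proof.
apply: bfnorm_le => [|t]; first by rewrite addr_ge0// bfnorm_ge0.
by apply: le_trans (ler_normD _ _) _; apply: lerD; exact: bfnorm_ub.
Qed.

Fact bfnormZ_le a f : bfnorm (a *: f) <= `|a| * bfnorm f.
Proof.
apply: bfnorm_le => [|t]; first by rewrite mulr_ge0// bfnorm_ge0.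
by rewrite normrM ler_wpM2l// bfnorm_ub.
Qed.

Fact bfnormZ a f : bfnorm (a *: f) = `|a| * bfnorm f.
Proof.
apply/eqP; rewrite eq_le bfnormZ_le /=.
have [->|a0] := eqVneq a 0; first by rewrite normr0 mul0r bfnorm_ge0.
rewrite -ler_pdivlMl ?normr_gt0// -normfV.
by have := bfnormZ_le a^-1 (a *: f); rewrite scalerA mulVf// scale1r.
Qed.

Fact bfnorm_eq0 f : bfnorm f = 0 -> f = 0.
Proof.
move=> f0; apply: bfeltP => t; apply/normr0_eq0/le_anti.
by rewrite normr_ge0 -f0 bfnorm_ub.
Qed.

HB.instance Definition _ := @Lmodule_isNormed.Build R (bfelt V) bfnorm
  bfnormD bfnormZ bfnorm_eq0.

Lemma bf_ub f t : `|f t| <= `|f|. Proof. exact: bfnorm_ub. Qed.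

Lemma bf_le f M : 0 <= M -> (forall t, `|f t| <= M) -> `|f| <= M.
Proof. exact: bfnorm_le. Qed.

Lemma bfD f g t : (f + g) t = f t + g t. Proof. by []. Qed.
Lemma bfN f t : (- f) t = - f t. Proof. by rewrite /= mulN1r. Qed.
Lemma bfB f g t : (f - g) t = f t - g t. Proof. by rewrite bfD bfN. Qed.
Lemma bfZ a f t : (a *: f) t = a * f t. Proof. by []. Qed.

Fact bf_complete (F : set_system (bfelt V)) :
  ProperFilter F -> cauchy F -> cvg F.
Proof.
move=> FF /cauchyP Fc.
have near_ball (e : R) : 0 < e -> exists f : bfelt V, \forall g \near F, `|f - g| < e.
  move=> e0; have [f Ff] := Fc _ e0; by exists f.
have Ft t : cvg ((fun f : bfelt V => f t) @ F).
  apply: cauchy_cvg; apply/cauchyP => e e0.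
  have [f Ff] := near_ball _ e0; exists (f t).
  apply: filterS Ff => g fg; rewrite /= -ball_normE /=.
  by apply: le_lt_trans fg; rewrite -bfB bf_ub.
pose l t := lim ((fun f : bfelt V => f t) @ F).
have lP e f : (\forall g \near F, `|f - g| < e) -> forall t, `|l t - f t| <= e.
  move=> Ff t; rewrite distrC.
  apply: (@cvgr_to_le _ F _ R (fun g : bfelt V => `|f t - g t|)).
  - apply: cvg_norm; apply: cvgB; [exact: cvg_cst|exact: Ft].
  - by apply: filterS Ff => g /ltW fg; apply: le_trans fg; rewrite -bfB bf_ub.
have Vl : V l.
  apply: bfmem_closed => e e0; have [f Ff] := near_ball _ e0.
  by exists f; [exact: bffunP|exact: lP Ff].
apply/cvg_ex; exists (BFElt Vl); apply/cvgrPdist_le => e e0.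
have [f Ff] := near_ball _ (divr_gt0 e0 (ltr0n _ 2)).
apply: filterS (Ff) => g fg; rewrite (splitr e).
apply: le_trans (ler_distD f _ _) _; apply: lerD; last exact: ltW.
apply: bf_le => [|t]; first by rewrite divr_ge0// ltW.
by rewrite bfB; exact: lP Ff t.
Qed.

HB.instance Definition _ := Uniform_isComplete.Build (bfelt V) bf_complete.

End BoundedFunctions.

(** * Lipschitz functions and the Lipschitz-free space *)

Section Lipschitz.
Context {R : realType} {X : normedModType R}.
Implicit Types (f g : X -> R) (K : R) (s : seq (R * X)) (m : (X -> R) -> R).

Definition lip K f := forall x y, `|f x - f y| <= K * `|x - y|.

Lemma lip_le K K' f : K <= K' -> lip K f -> lip K' f.
Proof. by move=> KK' fK x y; apply: le_trans (fK x y) _; rewrite ler_wpM2r. Qed.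

Lemma lip_cst K (a : R) : 0 <= K -> lip K (fun=> a).
Proof. by move=> K0 x y; rewrite subrr normr0 mulr_ge0. Qed.

Lemma lipD K K' f g : lip K f -> lip K' g -> lip (K + K') (fun x => f x + g x).
Proof.
move=> fK gK x y; rewrite opprD addrACA mulrDl.
by apply: le_trans (ler_normD _ _) _; apply: lerD.
Qed.

Lemma lipZ K a f : lip K f -> lip (`|a| * K) (fun x => a * f x).
Proof. by move=> fK x y; rewrite -mulrBr normrM -mulrA ler_wpM2l. Qed.

Lemma lipN K f : lip K f -> lip K (fun x => - f x).
Proof. by move=> fK x y; rewrite -opprD normrN. Qed.

Lemma norm_maxB (a b c d e : R) : `|a - c| <= e -> `|b - d| <= e ->
  `|Num.max a b - Num.max c d| <= e.
Proof.
rewrite !ler_norml => /andP[? ?] /andP[? ?].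
by have [?|?] := leP a b; have [?|?] := leP c d; apply/andP; split; lra.
Qed.

Lemma lip_max K f g : lip K f -> lip K g -> lip K (fun x => Num.max (f x) (g x)).
Proof. by move=> fK gK x y; apply: norm_maxB. Qed.

Lemma lip_min K f g : lip K f -> lip K g -> lip K (fun x => Num.min (f x) (g x)).
Proof.
move=> /lipN fK /lipN gK x y; rewrite -(opprK (f x)) -(opprK (g x)).
rewrite -(opprK (f y)) -(opprK (g y)) -!oppr_max -opprD normrN.
exact: lip_max fK gK x y.
Qed.

Lemma lip_dist (a : X) : lip 1 (fun x => `|x - a|).
Proof.
move=> x y; rewrite mul1r; apply: le_trans (ler_dist_dist _ _) _.
by rewrite opprB addrA subrK.
Qed.

Lemma lip_gt0 K f : lip K f -> exists2 K', 0 < K' & lip K' f.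
Proof.
move=> fK; exists (Num.max 1 K); first by rewrite lt_max ltr01.
by apply: lip_le fK; rewrite le_max lexx orbT.
Qed.

Definition comb s f := \sum_(p <- s) p.1 * (f p.2 - f 0).

(* The finite combinations of the evaluations [f |-> f x - f 0] are dense in
   the Lipschitz-free space of X; this is membership in that space. *)
Definition lipfree m := forall e, 0 < e -> exists s, forall K f, 0 < K -> lip K f ->
  `|m f - comb s f| <= e * K.

(** Functionals are controlled only up to every [e] times a Lipschitz constant; this extracts exact
    equalities. *)
Lemma eq_small (a b C : R) : (forall e, 0 < e -> `|a - b| <= e * C) -> a = b.
Proof.
move=> h; apply/eqP; rewrite -subr_eq0 -normr_eq0 eq_le normr_ge0 andbT.
rewrite leNgt; apply/negP => ab0.
have C0 : 0 < C by have := lt_le_trans ab0 (h 1 ltr01); rewrite mul1r.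
have := h (`|a - b| / C / 2) ltac:(by rewrite !divr_gt0).
rewrite mulrAC divfK ?gt_eqF//; lra.
Qed.

Lemma combD s f g : comb s (fun x => f x + g x) = comb s f + comb s g.
Proof.
by rewrite /comb -big_split /=; apply: eq_bigr => p _; ring.
Qed.

Lemma combZ s a f : comb s (fun x => a * f x) = a * comb s f.
Proof. by rewrite /comb big_distrr /=; apply: eq_bigr => p _; ring. Qed.

Lemma comb_le s : exists2 N, 0 <= N & forall K f, lip K f -> `|comb s f| <= N * K.
Proof.
exists (\sum_(p <- s) `|p.1| * `|p.2|).
  by apply: sumr_ge0 => p _; rewrite mulr_ge0.
move=> K f fK; rewrite mulr_suml; apply: le_trans (ler_norm_sum _ _ _) _.
apply: ler_sum => p _; rewrite normrM -mulrA ler_wpM2l// mulrC.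
by have := fK p.2 0; rewrite subr0.
Qed.

Definition zcomb a s : seq (R * X) := [seq (a * p.1, p.2) | p <- s].

Lemma comb_zcomb a s f : comb (zcomb a s) f = a * comb s f.
Proof. by rewrite /comb big_map big_distrr /=; apply: eq_bigr => p _; ring. Qed.

Lemma comb_cat s s' f : comb (s ++ s') f = comb s f + comb s' f.
Proof. by rewrite /comb big_cat. Qed.

Lemma lipfree_eval x : lipfree (fun f => f x - f 0).
Proof.
move=> e e0; exists [:: (1, x)] => K f K0 _.
by rewrite /comb big_seq1 /= mul1r subrr normr0 mulr_ge0// ltW.
Qed.

Lemma lipfree_lin a m m' : lipfree m -> lipfree m' -> lipfree (fun f => a * m f + m' f).
Proof.
move=> mF m'F e e0.
(* Adding 1 keeps the divisor positive when [a] is 0. *)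
have a1 : 0 < `|a| + 1 by rewrite ltr_wpDl.
have [s sm] := mF (e / 2 / (`|a| + 1)) ltac:(by rewrite !divr_gt0).
have [s' sm'] := m'F (e / 2) ltac:(by rewrite divr_gt0).
exists (zcomb a s ++ s') => K f K0 fK; rewrite comb_cat comb_zcomb.
rewrite opprD addrACA -mulrBr (splitr e) mulrDl.
apply: le_trans (ler_normD _ _) _; apply: lerD; last exact: sm'.
rewrite normrM; apply: (@le_trans _ _ ((`|a| + 1) * `|m f - comb s f|)).
  by rewrite ler_wpM2r// lerDl.
apply: (@le_trans _ _ ((`|a| + 1) * (e / 2 / (`|a| + 1) * K))).
  by rewrite ler_pM2l//; exact: sm.
by rewrite mulrA mulrCA divff ?gt_eqF// mulr1.
Qed.

Lemma lipfree_comb s : lipfree (comb s).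
Proof. by move=> e e0; exists s => K f K0 _; rewrite subrr normr0 mulr_ge0// ltW. Qed.

Lemma lipfree_limit m :
  (forall e, 0 < e -> exists2 m', lipfree m' &
     forall K f, 0 < K -> lip K f -> `|m f - m' f| <= e * K) -> lipfree m.
Proof.
move=> h e e0; have e20 : 0 < e / 2 by rewrite divr_gt0.
have [m' m'F mm'] := h _ e20; have [s sm'] := m'F _ e20.
exists s => K f K0 fK; rewrite (splitr e) mulrDl.
by apply: le_trans (ler_distD (m' f) _ _) _; apply: lerD; [exact: mm'|exact: sm'].
Qed.

Lemma lipfree_bound m : lipfree m ->
  exists2 N, 0 <= N & forall K f, 0 < K -> lip K f -> `|m f| <= N * K.
Proof.
move=> /(_ 1 ltr01)[s sm]; have [N N0 sN] := comb_le s.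
exists (1 + N) => [|K f K0 fK]; first by rewrite addr_ge0.
rewrite -(subrK (comb s f) (m f)) mulrDl.
by apply: le_trans (ler_normD _ _) _; apply: lerD; [exact: sm|exact: sN].
Qed.

(** A priori [m] is an arbitrary map; on Lipschitz functions it inherits additivity from the
    combinations approximating it. *)
Lemma lipfreeD m K f g : lipfree m -> lip K f -> lip K g ->
  m (fun x => f x + g x) = m f + m g.
Proof.
move=> mF /lip_gt0[K1 K10 fK] /lip_gt0[K2 K20 gK].
apply: (@eq_small _ _ ((K1 + K2) *+ 2)) => e e0; have [s sm] := mF _ e0.
have := sm _ _ (addr_gt0 K10 K20) (lipD fK gK).
have := sm _ _ K10 fK; have := sm _ _ K20 gK.
rewrite combD mulrnAr mulrDr !ler_norml => /andP[? ?] /andP[? ?] /andP[? ?].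
by apply/andP; split; lra.
Qed.

Lemma lipfreeZ m K a f : lipfree m -> lip K f -> m (fun x => a * f x) = a * m f.
Proof.
move=> mF /lip_gt0[K1 K10 fK].
have aK : lip ((`|a| + 1) * K1) (fun x => a * f x).
  by apply: lip_le (lipZ a fK); rewrite ler_wpM2r ?ltW// ltrDl.
have a1 : 0 < `|a| + 1 by rewrite ltr_wpDl.
apply: (@eq_small _ _ (((`|a| + 1) * K1) *+ 2)) => e e0; have [s sm] := mF _ e0.
have h1 := sm _ _ (mulr_gt0 a1 K10) aK; have h2 := sm _ _ K10 fK.
rewrite -(subrK (comb s (fun x => a * f x)) (m _)) -addrA combZ.
rewrite -mulrBr mulrnAr mulr2n; apply: le_trans (ler_normD _ _) _.
apply: lerD; first by rewrite -combZ.
rewrite normrM distrC mulrCA; apply: ler_pM => //.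
by rewrite lerDl.
Qed.

End Lipschitz.

(** * Corrections by spikes and the evaluation map *)

Section Spikes.
Context {R : realType} {X : normedModType R} {I : choiceType}.
Variables (i0 : I) (c : I -> X) (r : I -> R) (m : I -> (X -> R) -> R).
Implicit Types (S : I -> Prop) (i j : I) (w : I -> R) (f : X -> R).

(** The spike lives in the ball of radius [r i / 8] about [c i]. The separation of the centers makes
    these supports disjoint, and [c_norm] keeps them off 0. *)
Definition spike i x : R := Num.max 0 (1 - 8 / r i * `|x - c i|).

Definition active S x := xget i0 [set i | S i /\ 0 < spike i x].

(* The sum of [w i * spike i x] over [S], which has at most one nonzero term as
   the spikes have disjoint supports; [active] is junk if there is none. *)
Definition bsum S w x : R :=
  if `[< S (active S x) >] then w (active S x) * spike (active S x) x else 0.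

(* The weights make [correct S f (c i) - correct S f 0 = m i f] for [S i]. *)
Definition weight f i : R := m i f - (f (c i) - f 0).
Definition correct S f x : R := f x + bsum S (weight f) x.

Hypothesis r_ge : forall i, 128 <= r i.
Hypothesis c_norm : forall i, `|c i| = r i.
Hypothesis c_sep : forall i j, i <> j -> (r i + r j) / 2 <= `|c i - c j|.

Lemma r_gt0 i : 0 < r i. Proof. by apply: lt_le_trans (r_ge i). Qed.

Lemma spike_ge0 i x : 0 <= spike i x. Proof. by rewrite le_max lexx. Qed.

Lemma spike_center i : spike i (c i) = 1.
Proof. by rewrite /spike subrr normr0 mulr0 subr0; apply/max_idPr. Qed.

Lemma spike_gt0P i x : 0 < spike i x -> `|x - c i| < r i / 8.
Proof.
rewrite lt_max ltxx /= subr_gt0 -ltr_pdivlMl ?divr_gt0 ?r_gt0//.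
by rewrite mulr1 invf_div.
Qed.

Lemma spike_far i x : r i / 8 <= `|x - c i| -> spike i x = 0.
Proof.
move=> far; apply/eqP; rewrite eq_le spike_ge0 andbT leNgt.
by apply/negP => /spike_gt0P; rewrite ltNge far.
Qed.

Lemma spike_lip i : lip (8 / r i) (spike i).
Proof.
have k0 : 0 <= 8 / r i by rewrite divr_ge0 ?ltW ?r_gt0.
apply: lip_max; first exact: lip_cst.
move=> x y /=; have := lip_dist (c i) y x; rewrite mul1r (distrC y x) => h.
have -> : 1 - 8 / r i * `|x - c i| - (1 - 8 / r i * `|y - c i|) =
  8 / r i * (`|y - c i| - `|x - c i|) by ring.
by rewrite normrM (ger0_norm k0) ler_wpM2l.
Qed.

Lemma spike_disjoint i j x : 0 < spike i x -> 0 < spike j x -> i = j.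
Proof.
move=> /spike_gt0P xi /spike_gt0P xj; apply: contrapT => ij.
have := c_sep ij; have := ler_distD x (c i) (c j); rewrite (distrC (c i) x).
by have := r_gt0 i; have := r_gt0 j; lra.
Qed.

Lemma spike_origin i : spike i 0 = 0.
Proof.
by apply: spike_far; rewrite sub0r normrN c_norm; have := r_gt0 i; lra.
Qed.

Lemma bsum_active S w i x : S i -> 0 < spike i x -> bsum S w x = w i * spike i x.
Proof.
move=> Si ix; rewrite /bsum /active; case: xgetP => [j _ [Sj jx]|/(_ i)/=]; last first.
  by case.
by rewrite (spike_disjoint ix jx); case: asboolP.
Qed.

Lemma bsum_inactive S w x : (forall i, S i -> spike i x = 0) -> bsum S w x = 0.
Proof. by move=> S0; rewrite /bsum; case: asboolP => // /S0 ->; rewrite mulr0. Qed.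

Lemma bsumP S w x :
  (exists i, [/\ S i, 0 < spike i x & bsum S w x = w i * spike i x]) \/
   ((forall i, S i -> spike i x = 0) /\ bsum S w x = 0).
Proof.
have [[i [Si ix]]|none] := pselect (exists i, S i /\ 0 < spike i x).
  by left; exists i; split => //; exact: bsum_active.
have S0 i : S i -> spike i x = 0.
  move=> Si; apply/eqP; rewrite eq_le spike_ge0 andbT leNgt; apply/negP => ix.
  by apply: none; exists i.
by right; rewrite bsum_inactive.
Qed.

Lemma bsum_origin S w : bsum S w 0 = 0.
Proof. by apply: bsum_inactive => i _; exact: spike_origin. Qed.

Lemma bsum_center S w i : S i -> bsum S w (c i) = w i.
Proof. by move=> Si; rewrite (bsum_active _ Si) ?spike_center ?mulr1. Qed.

(** One term has slope at most [K * r i * (8 / r i)], that is [8 * K]. Between two spikes, each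
    vanishes at the other point and the two bounds add up. *)
Lemma bsum_lip S w K : 0 <= K -> (forall i, S i -> `|w i| <= K * r i) ->
  lip (16 * K) (bsum S w).
Proof.
move=> K0 wK.
have term i x y : S i -> `|w i * spike i x - w i * spike i y| <= 8 * K * `|x - y|.
  move=> Si; have ixy := spike_lip i x y; rewrite -mulrBr normrM.
  apply: le_trans (ler_pM _ _ (wK i Si) ixy) _ => //.
  rewrite mulrA ler_wpM2r// (_ : K * r i * (8 / r i) = 8 * K)//.
  by field; rewrite gt_eqF ?r_gt0.
have one i x y : S i -> 0 < spike i x -> spike i y = 0 ->
    `|bsum S w x| <= 8 * K * `|x - y|.
  move=> Si ix iy; rewrite (bsum_active _ Si ix).
  by have := term i x y Si; rewrite iy mulr0 subr0.
have inact i x : S i -> 0 < spike i x -> forall j, j <> i -> spike j x = 0.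
  move=> Si ix j ji; apply/eqP; rewrite eq_le spike_ge0 andbT leNgt.
  by apply/negP => jx; apply: ji; exact: spike_disjoint jx ix.
have K8 (x y : X) : 8 * K * `|x - y| <= 16 * K * `|x - y|.
  by rewrite ler_wpM2r//; lra.
move=> x y.
have [[i [Si ix ex]]|[x0 ex]] := bsumP S w x;
  have [[j [Sj jy ey]]|[y0 ey]] := bsumP S w y.
- have [ij|ij] := pselect (i = j).
    by rewrite ex ey -ij; exact: le_trans (term i x y Si) (K8 x y).
  apply: le_trans (ler_normB _ _) _.
  have h1 := one i x y Si ix (inact j y Sj jy i ij).
  have h2 := one j y x Sj jy (inact i x Si ix j (nesym ij)).
  rewrite distrC in h2; rewrite (_ : 16 * K = 8 * K + 8 * K); last by ring.
  by rewrite mulrDl lerD.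
- by rewrite ey subr0; exact: le_trans (one i x y Si ix (y0 i Si)) (K8 x y).
- rewrite ex sub0r normrN (distrC x y).
  exact: le_trans (one j y x Sj jy (x0 j Sj)) (K8 y x).
- by rewrite ex ey subrr normr0 mulr_ge0// mulr_ge0.
Qed.

(** * Correcting Lipschitz functions to meet the constraints at the centers *)

Section System.
Variables (S : I -> Prop) (dom : I -> X -> Prop).
Hypothesis m_free : forall i, S i -> lipfree (m i).
Hypothesis m_bound : forall i K f, S i -> 0 < K -> lip K f ->
  `|m i f| <= (r i / 32 - 4) * K.
Hypothesis m_local : forall i f g, (forall x, dom i x -> f x = g x) -> m i f = m i g.
Hypothesis m_bsum : forall i w K, S i -> 0 <= K -> (forall j, S j -> `|w j| <= K * r j) ->
  m i (bsum S w) = 0.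
Hypothesis dom0 : forall i, dom i 0.
Hypothesis dom_far : forall i x, dom i x -> r i <= `|c i - x|.

Lemma m_local0 i f : S i -> (forall x, dom i x -> f x = 0) -> m i f = 0.
Proof.
move=> Si f0; rewrite (m_local (g := fun=> 0 * 0)) => [|x /f0 ->]; last by rewrite mul0r.
by rewrite (lipfreeZ (f := fun=> 0) _ (m_free Si) (lip_cst _ (lexx 0))) mul0r.
Qed.

Lemma weight_le f K i : S i -> 0 < K -> lip K f -> `|weight f i| <= 2 * K * r i.
Proof.
move=> Si K0 fK; apply: le_trans (ler_normB _ _) _.
have h1 := m_bound Si K0 fK; have := fK (c i) 0; rewrite subr0 c_norm => h2.
by have := mulr_gt0 K0 (r_gt0 i); move: h1; rewrite mulrBl; lra.
Qed.

Lemma correct_lip f K : 0 < K -> lip K f -> lip (33 * K) (correct S f).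
Proof.
move=> K0 fK; rewrite (_ : 33 * K = K + 16 * (2 * K)); last by ring.
apply: (lipD fK); apply: bsum_lip => [|i Si]; first by rewrite mulr_ge0// ltW.
exact: weight_le Si K0 fK.
Qed.

Definition compatible f := forall i, S i -> f (c i) - f 0 = m i f.

Lemma correct_origin f : correct S f 0 = f 0.
Proof. by rewrite /correct bsum_origin addr0. Qed.

Lemma correct_center f i : S i -> correct S f (c i) - correct S f 0 = m i f.
Proof.
by move=> Si; rewrite correct_origin /correct bsum_center// /weight; ring.
Qed.

Lemma m_correct f K i : S i -> 0 < K -> lip K f -> m i (correct S f) = m i f.
Proof.
move=> Si K0 fK; have K2 : 0 <= 2 * K by rewrite mulr_ge0// ltW.
have wK j : S j -> `|weight f j| <= 2 * K * r j by move=> Sj; exact: weight_le Sj K0 fK.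
have h2 := bsum_lip K2 wK.
have K' : K <= 32 * K by lra.
rewrite /correct (lipfreeD (m_free Si) (lip_le K' fK)) ?(m_bsum Si K2 wK) ?addr0//.
by apply: lip_le h2; lra.
Qed.

(** The correction enforces the value [m i f] at [c i], and [m i] does not notice it since it kills
    spike sums. *)
Lemma correct_compatible f K : 0 < K -> lip K f -> compatible (correct S f).
Proof. by move=> K0 fK i Si; rewrite correct_center// (m_correct Si K0 fK). Qed.

Lemma correct_id f : compatible f -> correct S f = f.
Proof.
move=> fc; apply/funext => x; rewrite /correct.
have [[i [Si _ ->]]|[_ ->]] := bsumP S (weight f) x; last by rewrite addr0.
by rewrite /weight fc// subrr mul0r addr0.
Qed.

(** With [correct_compatible] and [correct_id], [correct S] acts as a projection onto the compatible
    functions along the spike sums. *)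
Lemma correct_bsum w K : 0 <= K -> (forall j, S j -> `|w j| <= K * r j) ->
  correct S (bsum S w) = fun=> 0.
Proof.
move=> K0 wK; apply/funext => x; rewrite /correct.
have [[i [Si ix ->]]|[x0 ->]] := bsumP S (weight (bsum S w)) x; last first.
  by rewrite addr0 bsum_inactive.
rewrite /weight (m_bsum Si K0 wK) bsum_center// bsum_origin.
by rewrite (bsum_active _ Si ix); ring.
Qed.

(* The representative of the evaluation at [x] that kills all [bsum S w]. *)
Definition normal_form x f : R := correct S f x - correct S f 0.

Hypothesis dom_closed : forall i x, ~ dom i x ->
  exists2 e, 0 < e & forall y, dom i y -> e <= `|y - x|.

(** * Separating and norming by truncated functions *)

Lemma tent_lip (x : X) (e : R) : lip 1 (fun z => Num.max 0 (e - `|z - x|)).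
Proof.
apply: lip_max => [|y z] /=; first exact: lip_cst.
have -> : e - `|y - x| - (e - `|z - x|) = `|z - x| - `|y - x| by ring.
by rewrite (distrC y z); exact: lip_dist.
Qed.

(** Take a tent at [x] so narrow that it vanishes at 0, at [q], and at the center and on the domain
    of any spike alive at [x] or [q]. The weights that matter are 0, and the two normal forms take
    the values [e] and 0. *)
Lemma normal_form_separates x q : x <> 0 -> (forall i, S i -> x <> c i) -> q <> x ->
  (forall i, S i -> 0 < spike i q -> ~ dom i x) ->
  exists2 f, lip 1 f & normal_form x f <> normal_form q f.
Proof.
move=> x0 xc qx qdom.
have [e1 e10 e1P] : exists2 e, 0 < e & forall i, S i -> 0 < spike i x -> e <= `|c i - x|.
  have [[i [Si ix _]]|[no _]] := bsumP S (fun=> 0) x; last first.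
    by exists 1 => // i Si; rewrite no// ltxx.
  exists `|c i - x|; first by rewrite normr_gt0 subr_eq0; apply/eqP/nesym/xc.
  by move=> j Sj jx; rewrite (spike_disjoint jx ix).
have [e2 e20 e2P] : exists2 e, 0 < e & forall i, S i -> 0 < spike i q ->
    e <= `|c i - x| /\ forall y, dom i y -> e <= `|y - x|.
  have [[i [Si iq _]]|[no _]] := bsumP S (fun=> 0) q; last first.
    by exists 1 => // i Si; rewrite no// ltxx.
  have [e e0 eP] := dom_closed (qdom i Si iq).
  exists (Num.min e `|c i - x|).
    by rewrite lt_min e0 normr_gt0 subr_eq0; apply/eqP/nesym/xc.
  move=> j Sj jq; rewrite (spike_disjoint jq iq); split.
    by rewrite ge_min lexx orbT.
  by move=> y /eP yx; rewrite ge_min yx.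
pose e := Num.min (Num.min e1 e2) (Num.min (Num.min `|x| `|q - x|) 1).
have e_gt0 : 0 < e.
  rewrite !lt_min e10 e20 ltr01 !normr_gt0 subr_eq0 /= andbT.
  by apply/andP; split; apply/eqP.
have [ee1 ee2] : e <= e1 /\ e <= e2.
  by split; rewrite !ge_min lexx ?orbT.
have [ex eq1] : e <= `|x| /\ e <= `|q - x|.
  by split; rewrite !ge_min lexx ?orbT.
have e1' : e <= 1 by rewrite !ge_min lexx ?orbT.
pose f z : R := Num.max 0 (e - `|z - x|).
have f0 z : e <= `|z - x| -> f z = 0.
  by move=> zx; apply/max_idPl; rewrite subr_le0.
have fx : f x = e by rewrite /f subrr normr0 subr0; apply/max_idPr/ltW.
have forig : f 0 = 0 by apply: f0; rewrite sub0r normrN.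
exists f; first exact: tent_lip.
rewrite /normal_form !correct_origin forig !subr0 /correct fx (f0 q)//.
have -> : bsum S (weight f) x = 0.
  have [[i [Si ix ->]]|[_ //]] := bsumP S (weight f) x.
  have fc : f (c i) = 0 by apply: f0; exact: le_trans ee1 (e1P _ Si ix).
  have mf : m i f = 0.
    (* [x] is within [r i / 8] of [c i], while the domain of [i] is at distance at least [r i]; the
       tent has radius at most 1. *)
    apply: m_local0 => // y /dom_far yi; apply: f0.
    have := spike_gt0P ix; have := r_ge i; have := ler_distD x (c i) y.
    by rewrite (distrC (c i) x) (distrC x y); lra.
  by rewrite /weight mf fc forig !subrr mul0r.
have -> : bsum S (weight f) q = 0; last by rewrite !addr0; apply/eqP; rewrite gt_eqF.
have [[i [Si iq ->]]|[_ //]] := bsumP S (weight f) q.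
have [ci di] := e2P _ Si iq.
have fc : f (c i) = 0 by apply: f0; exact: le_trans ee2 ci.
have mf : m i f = 0.
  by apply: m_local0 => // y /di yx; apply: f0; exact: le_trans ee2 yx.
by rewrite /weight mf fc forig !subrr mul0r.
Qed.

(** The distance to [q], shifted to vanish at [a], is truncated to the ball of radius [K] about [a],
    so it vanishes at all constrained centers. Its correction adds only spikes far from [p], of
    slope at most 1/2. *)
Lemma norming (p q a : X) (K : R) : K <= 3 -> `|p - a| <= 1 ->
  `|p - a| *+ 2 <= K -> `|q - a| *+ 2 <= K -> `|p - q| <= 1 ->
  (forall i, S i -> c i = a \/ K <= `|c i - a|) ->
  exists2 f, lip 1 f /\ compatible f & f p - f q = `|p - q|.
Proof.
move=> K3 pa1 pa qa pq ca.
pose f0 z : R := `|z - q| - `|a - q|.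
pose h z : R := Num.max 0 (K - `|z - a|).
pose f z : R := Num.max (- h z) (Num.min (f0 z) (h z)).
have f0a z : `|f0 z| <= `|z - a|.
  by apply: le_trans (ler_dist_dist _ _) _; rewrite opprB addrA subrK.
have h_ge0 z : 0 <= h z by rewrite le_max lexx.
have h_ge z : K - `|z - a| <= h z by rewrite le_max lexx orbT.
have f_lip : lip 1 f.
  have hl : lip 1 h by exact: tent_lip.
  apply: lip_max; first exact: lipN.
  apply: lip_min => // x y; rewrite /f0.
  have -> : `|x - q| - `|a - q| - (`|y - q| - `|a - q|) = `|x - q| - `|y - q| by ring.
  exact: lip_dist.
have f_h z : `|f z| <= h z.
  rewrite ler_norml /f le_max lexx /= ge_max ge_min lexx orbT andbT.
  by rewrite (le_trans _ (h_ge0 z))// oppr_le0.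
have f_f0 z : `|f0 z| <= h z -> f z = f0 z.
  rewrite ler_norml => /andP[l u].
  by rewrite /f (min_idPl u) (max_idPr l).
have f_a z : `|f z| <= `|z - a|.
  have hz := h_ge0 z; have := f0a z; rewrite !ler_norml => /andP[? ?].
  rewrite /f le_max ge_max le_min ge_min.
  have [hza|hza] := leP (h z) `|z - a|.
    by apply/andP; split; [apply/orP; left; lra|apply/andP; split; [lra|apply/orP; left; lra]].
  by apply/andP; split; [apply/orP; right; apply/andP; split; lra|
    apply/andP; split; [lra|apply/orP; left; lra]].
have f_far z : K <= `|z - a| -> f z = 0.
  move=> zK; apply/normr0_eq0/le_anti; rewrite normr_ge0 andbT.
  by apply: le_trans (f_h z) _; rewrite ge_max lexx subr_le0.
have fc i : S i -> f (c i) = 0.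
  move=> Si; have [cia|/f_far //] := ca i Si.
  apply/normr0_eq0/le_anti; rewrite normr_ge0 andbT; have := f_a (c i).
  by rewrite {2}cia subrr normr0.
(* Half of the largest [K]: the bounds by the distance to [a] and by [h] cross at [K / 2]. *)
have f_le z : `|f z| <= 3 / 2.
  have := f_h z; have := f_a z; rewrite {1}/h; case: (leP 0 (K - `|z - a|)); lra.
(* The origin and the domain of [i] are at distance at least [r i] from [c i], hence too far from
   [p] for [f] to see them. *)
have w0 i : S i -> `|p - c i| < r i / 2 -> weight f i = 0.
  move=> Si pci; have ri := r_ge i.
  have d0 y : r i <= `|c i - y| -> f y = 0.
    move=> yi; apply: f_far.
    have := ler_distD p (c i) y; have := ler_distD a p y.
    by rewrite (distrC (c i) p) (distrC a y); lra.
  have f00 : f 0 = 0 by apply: d0; rewrite subr0 c_norm.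
  have mf : m i f = 0 by apply: m_local0 => // y /dom_far /d0.
  by rewrite /weight mf fc// f00 !subrr.
have wf z : `|z - p| <= 8 -> bsum S (weight f) z = 0.
  move=> zp; have [[i [Si iz ->]]|[_ //]] := bsumP S (weight f) z.
  rewrite w0 ?mul0r//; have := r_ge i; have := spike_gt0P iz.
  by have := ler_distD z p (c i); rewrite (distrC p z); lra.
(* The slack 4 in [m_bound] absorbs the value of [f] at 0, so the weights are at most [r i / 32]. *)
have w_lip : lip (1 / 2) (bsum S (weight f)).
  rewrite (_ : 1 / 2 = 16 * 32^-1); last by field.
  apply: bsum_lip => [|i Si]; first by rewrite invr_ge0.
  rewrite /weight (fc i Si) sub0r opprK; apply: le_trans (ler_normD _ _) _.
  by have := m_bound Si ltr01 f_lip; have := f_le 0; lra.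
have cl : lip 1 (correct S f).
  have half x y : f x <> 0 -> `|correct S f x - correct S f y| <= `|x - y|.
    move=> fx; have xa : `|x - a| < K by rewrite ltNge; apply/negP => /f_far.
    have xp : `|x - p| <= 8.
      by have := ler_distD a x p; rewrite (distrC a p); lra.
    rewrite /correct (wf x xp) addr0.
    have [yp|yp] := leP `|y - p| 8.
      by rewrite (wf y yp) addr0; have := f_lip x y; rewrite mul1r.
    (* [x] is within 4 of [p] and [y] farther than 8, so the distance from [x] to [y] exceeds 4;
       half of it dominates the bound 3/2 on [f x]. *)
    have h1 := ler_distD a x p; have h2 := ler_distD x y p.
    have h3 := ler_distD a y p; have h4 := w_lip x y; have h5 := f_le x.
    rewrite (distrC a p) in h1 h3; rewrite (distrC y x) in h2.
    rewrite (wf x xp) sub0r normrN in h4.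
    rewrite (f_far y) ?add0r; last by lra.
    by apply: le_trans (ler_normB _ _) _; lra.
  move=> x y; rewrite mul1r.
  have [fx|/half //] := pselect (f x = 0).
  have [fy|/(half y x)] := pselect (f y = 0); last first.
    by rewrite (distrC x y) (distrC (correct S f x)).
  rewrite /correct fx fy !add0r; apply: le_trans (w_lip x y) _.
  by have := normr_ge0 (x - y); lra.
exists (correct S f).
  by split=> //; exact: correct_compatible ltr01 f_lip.
have qp : `|q - p| <= 8 by rewrite distrC; lra.
rewrite /correct !wf ?subrr ?normr0// !addr0 !f_f0.
- by rewrite /f0 subrr normr0; ring.
- by apply: le_trans (f0a q) (le_trans _ (h_ge q)); lra.
- by apply: le_trans (f0a p) (le_trans _ (h_ge p)); lra.
Qed.

(* With a center [c i] close to [p] the norming function must vanish at [c i]. *)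
Lemma compatible_norming (p q : X) : `|p - q| <= 1 / 2 ->
  exists2 f, lip 1 f /\ compatible f & f p - f q = `|p - q|.
Proof.
move=> pq; have [[i [Si pi]]|far] := pselect (exists i, S i /\ `|p - c i| < 1).
  have h := ler_distD p q (c i); rewrite (distrC q p) in h.
  (* 3 is twice the bound 1/2 + 1 for the distance from [q] to [c i]; the other centers are at least
     128 away. *)
  apply: (@norming p q (c i) 3); rewrite ?mulr2n; try lra.
  move=> j Sj; have [->|ji] := pselect (j = i); [by left|right].
  by have := c_sep ji; have := r_ge i; have := r_ge j; lra.
apply: (@norming p q p 1); rewrite ?subrr ?normr0 ?mulr2n ?(distrC q p); try lra.
move=> i Si; right; rewrite leNgt; apply/negP => ip; apply: far.
by exists i; rewrite distrC.
Qed.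

Lemma normal_form_center i f : S i -> normal_form (c i) f = m i f.
Proof. exact: correct_center. Qed.

Lemma normal_form_free x : lipfree (normal_form x).
Proof.
have [[i [Si ix]]|no] := pselect (exists i, S i /\ 0 < spike i x); last first.
  rewrite (_ : normal_form x = fun f => f x - f 0); first exact: lipfree_eval.
  apply/funext => f; rewrite /normal_form correct_origin /correct.
  have [[i [Si ix _]]|[_ ->]] := bsumP S (weight f) x; last by rewrite addr0.
  by exfalso; apply: no; exists i.
rewrite (_ : normal_form x = fun f => spike i x *
    (-1 * (f (c i) - f 0) + m i f) + (f x - f 0)); last first.
  apply/funext => f; rewrite /normal_form correct_origin /correct.
  by rewrite (bsum_active _ Si ix) /weight; ring.
apply: lipfree_lin; last exact: lipfree_eval.
by apply: lipfree_lin; [exact: lipfree_eval|exact: m_free].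
Qed.

Lemma comb_correct_free s : lipfree (fun f => comb s (correct S f)).
Proof.
elim: s => [|p s IHs].
  rewrite (_ : (fun _ => _) = comb [::]); first exact: lipfree_comb.
  by apply/funext => f; rewrite /comb !big_nil.
rewrite (_ : (fun _ => _) =
  fun f => p.1 * normal_form p.2 f + comb s (correct S f)).
  exact: lipfree_lin (normal_form_free _) IHs.
by apply/funext => f; rewrite /comb big_cons.
Qed.

(** * The target space and the evaluation map *)

Definition test := {f : X -> R | lip 1 f /\ compatible f}.

(** The closed span of the evaluations in the bounded functions on [test]. *)
Definition approximable (y : test -> R) := forall e, 0 < e ->
  exists s : seq (R * X), forall f : test, `|y f - comb s (sval f)| <= e.

Fact approximable0 : approximable (fun=> 0).
Proof.
by move=> e e0; exists [::] => f; rewrite /comb big_nil subrr normr0 ltW.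
Qed.

Fact approximable_lin a y y' : approximable y -> approximable y' ->
  approximable (fun t => a * y t + y' t).
Proof.
move=> yA y'A e e0.
have a1 : 0 < `|a| + 1 by rewrite ltr_wpDl.
have [s sy] := yA (e / 2 / (`|a| + 1)) ltac:(by rewrite !divr_gt0).
have [s' sy'] := y'A (e / 2) ltac:(by rewrite divr_gt0).
exists (zcomb a s ++ s') => f; rewrite comb_cat comb_zcomb.
rewrite opprD addrACA -mulrBr (splitr e).
apply: le_trans (ler_normD _ _) _; apply: lerD; last exact: sy'.
rewrite normrM; apply: (@le_trans _ _ ((`|a| + 1) * `|y f - comb s (sval f)|)).
  by rewrite ler_wpM2r// lerDl.
by rewrite mulrC -ler_pdivlMr//; exact: sy.
Qed.

Fact approximable_bnd y : approximable y -> exists M, forall t, `|y t| <= M.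
Proof.
move=> /(_ 1 ltr01)[s sy]; have [N N0 sN] := comb_le s.
exists (1 + N) => f; rewrite -(subrK (comb s (sval f)) (y f)).
apply: le_trans (ler_normD _ _) _; apply: lerD; first exact: sy.
by rewrite -[N]mulr1; apply: sN; case: f => f [].
Qed.

Fact approximable_closed y :
  (forall e, 0 < e -> exists2 y', approximable y' & forall t, `|y t - y' t| <= e) ->
  approximable y.
Proof.
move=> h e e0; have e20 : 0 < e / 2 by rewrite divr_gt0.
have [y' y'A yy'] := h _ e20; have [s sy'] := y'A _ e20.
exists s => f; rewrite (splitr e).
by apply: le_trans (ler_distD (y' f) _ _) _; apply: lerD.
Qed.

Definition target_space := BFSpace approximable0 approximable_lin
  approximable_bnd approximable_closed.
Local Notation Y := (bfelt target_space).

Fact eval_approximable (x : X) : approximable (fun t => sval t x - sval t 0).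
Proof.
move=> e e0; exists [:: (1, x)] => f.
by rewrite /comb big_seq1 /= mul1r subrr normr0 ltW.
Qed.

Definition eval_map (x : X) : Y :=
  BFElt (V := target_space) (eval_approximable x).

Lemma eval_mapB p q (f : test) : (eval_map p - eval_map q) f = sval f p - sval f q.
Proof. by rewrite bfB /=; ring. Qed.

Lemma eval_map_short p q : `|p - q| <= 1 / 2 ->
  `|eval_map p - eval_map q| = `|p - q|.
Proof.
move=> pq; apply/eqP; rewrite eq_le; apply/andP; split.
  apply: bf_le => // f; rewrite eval_mapB.
  by have [fl _] := svalP f; have := fl p q; rewrite mul1r.
have [f fT <-] := compatible_norming pq.
have := bf_ub (eval_map p - eval_map q) (exist _ f fT).
by rewrite eval_mapB; apply: le_trans; rewrite ler_norm.
Qed.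

Lemma compatibleZ a K f : lip K f -> compatible f -> compatible (fun x => a * f x).
Proof.
by move=> fK fc i Si; rewrite -mulrBr fc// (lipfreeZ _ (m_free Si) fK).
Qed.

Lemma scaled_test K f : 0 < K -> lip K f -> compatible f ->
  lip 1 (fun x => K^-1 * f x) /\ compatible (fun x => K^-1 * f x).
Proof.
move=> K0 fK fc; split; last exact: compatibleZ fK fc.
by have := lipZ K^-1 fK; rewrite gtr0_norm ?invr_gt0// mulVf ?gt_eqF.
Qed.

Definition extend_test (y : test -> R) f : R :=
  if pselect (lip 1 f /\ compatible f) is left fT then y (exist _ f fT) else 0.

(** Homogeneous extension to compatible functions with any Lipschitz constant, such as those
    produced by [correct]. *)
Definition extend_cone (y : test -> R) f : R :=
  let K := xget 1 [set K | 0 < K /\ lip K f] in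
  K * extend_test y (fun x => K^-1 * f x).

Lemma extend_testE y (f : test) : extend_test y (sval f) = y f.
Proof.
case: f => f fT; rewrite /extend_test; case: pselect => // fT'.
by congr (y _); congr exist; exact: Prop_irrelevance.
Qed.

Fact extend_test_approx y e : approximable y -> 0 < e -> exists s, forall K f,
  0 < K -> lip K f -> compatible f ->
  `|K * extend_test y (fun x => K^-1 * f x) - comb s f| <= e * K.
Proof.
move=> yA e0; have [s sy] := yA _ e0; exists s => K f K0 fK fc.
have fT := scaled_test K0 fK fc.
have := sy (exist _ _ fT); rewrite -extend_testE combZ /= => h.
rewrite -[X in _ - X](mulVKf (lt0r_neq0 K0)) -mulrBr normrM gtr0_norm//.
by rewrite mulrC ler_pM2r.
Qed.

(** The choice of constant is immaterial: one combination approximates the rescaled values for all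
    admissible constants at once. *)
Lemma extend_coneE y K f : approximable y -> 0 < K -> lip K f -> compatible f ->
  extend_cone y f = K * extend_test y (fun x => K^-1 * f x).
Proof.
move=> yA K0 fK fc; rewrite /extend_cone /=.
have [] : [set L | 0 < L /\ lip L f] (xget 1 [set L | 0 < L /\ lip L f]).
  by apply: xgetPex; exists K.
move: (xget _ _) => L L0 fL.
apply: (@eq_small _ _ _ (L + K)) => d d0; have [s sy] := extend_test_approx yA d0.
rewrite mulrDr; apply: le_trans (ler_distD (comb s f) _ _) _.
by apply: lerD; [exact: sy|rewrite distrC; exact: sy].
Qed.

Lemma extend_cone_approx y e : approximable y -> 0 < e -> exists s, forall K f,
  0 < K -> lip K f -> compatible f -> `|extend_cone y f - comb s f| <= e * K.
Proof.
move=> yA e0; have [s sy] := extend_test_approx yA e0; exists s => K f K0 fK fc.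
by rewrite (extend_coneE yA K0 fK fc); exact: sy.
Qed.

(** Composing [extend_cone y] with [correct S] gives an element of the Lipschitz-free space killing
    spike sums, so the premise makes it the normal form of some [x]. On tests [correct S] is the
    identity, hence [y] is the evaluation at [x]. *)
Lemma eval_map_surj :
  (forall M, lipfree M ->
    (forall w K, 0 <= K -> (forall j, S j -> `|w j| <= K * r j) -> M (bsum S w) = 0) ->
    exists x, forall K f, 0 < K -> lip K f -> M f = normal_form x f) ->
  forall y : Y, exists x, eval_map x = y.
Proof.
move=> code y; have yA := bffunP y; pose M f := extend_cone y (correct S f).
have M_free : lipfree M.
  apply: lipfree_limit => e e0.
  have [s sy] := extend_cone_approx yA (divr_gt0 e0 (ltr0n R 33)).
  exists (fun f => comb s (correct S f)); first exact: comb_correct_free.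
  move=> K f K0 fK; have := sy _ _ _ (correct_lip K0 fK) (correct_compatible K0 fK).
  by rewrite mulrA divfK ?pnatr_eq0//; apply; rewrite mulr_gt0.
have [w K K0 wK|x Mx] := code M M_free.
  rewrite /M (correct_bsum K0 wK); apply: (@eq_small _ _ _ 1) => e e0.
  have [s sy] := extend_cone_approx yA e0.
  have := sy 1 (fun=> 0) ltr01 (lip_cst _ ler01).
  have -> : comb s (fun=> 0 : R) = 0.
    by rewrite /comb big1// => p _; rewrite subrr mulr0.
  apply=> i Si; rewrite subrr m_local0//.
exists x; apply: bfeltP => -[f [fl fc]].
have := Mx 1 f ltr01 fl; rewrite /normal_form /M correct_id// => /= <-.
rewrite (extend_coneE yA ltr01 fl fc) mul1r -(extend_testE y) /=.
by congr extend_test; apply/funext => z; rewrite invr1 mul1r.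
Qed.

(** Divided by [33 * K], the correction of [f] is a test, and evaluating there gives the normal
    forms up to this factor. *)
Lemma eval_map_inj p q : eval_map p = eval_map q ->
  forall K f, 0 < K -> lip K f -> normal_form p f = normal_form q f.
Proof.
move=> pq K f K0 fK; have K33 : 0 < 33 * K by rewrite mulr_gt0.
have fT := scaled_test K33 (correct_lip K0 fK) (correct_compatible K0 fK).
have := congr1 (fun y : Y => y (exist _ _ fT)) pq; rewrite /= -!mulrBr.
by move/(mulfI (invr_neq0 (lt0r_neq0 K33))).
Qed.

Lemma eval_map_contracts i : S i -> `|eval_map (c i) - eval_map 0| < `|c i - 0|.
Proof.
move=> Si; have ri := r_ge i; rewrite subr0 c_norm.
apply: (@le_lt_trans _ _ (r i / 32)); last by lra.
apply: bf_le => [|[f [fl fc]]]; first by lra.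
by rewrite eval_mapB /= fc//; have := m_bound Si ltr01 fl; lra.
Qed.

End System.
End Spikes.

(** * Coding by trees *)

Section Trees.
Context {R : realType}.

(* Indices are well-founded codes: [node ch d] names the functional
   [f |-> d (r |-> f x)], where [x] is the point supported in the range of [ch]
   with coordinates [r]. *)
Inductive tree := leaf | node of nat -> tree & ((nat -> R) -> R) -> R.

HB.instance Definition _ := gen_eqMixin tree.
HB.instance Definition _ := gen_choiceMixin tree.

Implicit Types (t u : tree) (ch : nat -> tree).

Definition child t u : Prop :=
  if u is node ch _ then exists n, t = ch n else False.

(** Well-foundedness enters the argument here: no index lies in its own domain ([domain_far]), and
    the cycle met at the end of [normal_form_inj] is impossible. *)
Lemma child_asym t u : child t u -> child u t -> False.
Proof.
elim: u t => [//|ch IH d] t [n ->] /= tn.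
by apply: (IH n _ tn); exists n.
Qed.

(** * The source space: countably supported bounded functions on trees *)

Definition supported ch (f : tree -> R) := forall t, (forall n, t <> ch n) -> f t = 0.

Lemma enum_union (chs : nat -> nat -> tree) :
  exists ch, forall n i, exists k, chs n i = ch k.
Proof.
exists (fun k => let p := odflt (0%N, 0%N) (unpickle k) in chs p.1 p.2) => n i.
by exists (pickle (n, i)); rewrite pickleK.
Qed.

(** Countable supports let the children of one node enumerate the coordinates of countably many
    points. *)
Definition source_mem (f : tree -> R) :=
  (exists M, forall t, `|f t| <= M) /\ exists ch, supported ch f.

Fact source_mem0 : source_mem (fun=> 0).
Proof. by split; [exists 0 => t; rewrite normr0|exists (fun=> leaf)]. Qed.

Fact source_mem_lin a f g : source_mem f -> source_mem g ->
  source_mem (fun t => a * f t + g t).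
Proof.
move=> [[M fM] [ch1 f1]] [[N gN] [ch2 g2]]; split.
  exists (`|a| * M + N) => t; apply: le_trans (ler_normD _ _) _.
  by rewrite normrM lerD// ler_wpM2l.
have [ch chP] := enum_union (fun n => if n is 0%N then ch1 else ch2).
exists ch => t tch; rewrite f1 ?g2 ?mulr0 ?addr0// => n tn.
  by have [k] := chP 1%N n; rewrite -tn => /tch.
by have [k] := chP 0%N n; rewrite -tn => /tch.
Qed.

Fact source_mem_bnd f : source_mem f -> exists M, forall t, `|f t| <= M.
Proof. by case. Qed.

Fact source_mem_closed f :
  (forall e, 0 < e -> exists2 g, source_mem g & forall t, `|f t - g t| <= e) ->
  source_mem f.
Proof.
move=> h; split.
  have [g [[M gM] _] fg] := h 1 ltr01; exists (1 + M) => t.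
  rewrite -(subrK (g t) (f t)); apply: le_trans (ler_normD _ _) _.
  exact: lerD.
have /choice[g gP] : forall n : nat, exists g, source_mem g /\
    forall t, `|f t - g t| <= n.+1%:R^-1.
  move=> n; have n0 : 0 < n.+1%:R^-1 :> R by rewrite invr_gt0 ltr0n.
  by have [g gM fg] := h _ n0; exists g.
have /choice[chs chsP] : forall n, exists ch, supported ch (g n).
  by move=> n; have [[_ ]] := gP n.
have [ch chP] := enum_union chs; exists ch => t tch.
have g0 n : g n t = 0.
  by apply: chsP => i ti; have [k] := chP n i; rewrite -ti => /tch.
apply/eqP; rewrite -normr_eq0 eq_le normr_ge0 andbT leNgt; apply/negP => ft.
have [n] := ltr_add_invr ft.
rewrite add0r ltNge => /negP; apply.
by have [_ /(_ t)] := gP n; rewrite g0 subr0.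
Qed.

Definition source_space := BFSpace source_mem0 source_mem_lin source_mem_bnd
  source_mem_closed.
Local Notation X := (bfelt source_space).
Implicit Types (x y : X) (M : (X -> R) -> R).

(** The default 0 occurs when [r] is unbounded or inconsistent with repetitions in [ch]. *)
Definition decode ch (r : nat -> R) : X :=
  xget 0 [set x : X | supported ch x /\ forall n, x (ch n) = r n].

Lemma supported0 ch : supported ch (0 : X). Proof. by []. Qed.

Lemma decode_supported ch r : supported ch (decode ch r).
Proof. by rewrite /decode; case: xgetP => [x _ []//|_]. Qed.

Lemma decodeK ch x : supported ch x -> decode ch (x \o ch) = x.
Proof.
move=> xch; rewrite /decode; case: xgetP => [y _ [ych yx]|/(_ x)/=]; last first.
  by case.
apply: bfeltP => t; have [[n ->]|no] := pselect (exists n, t = ch n).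
  exact: yx.
by rewrite xch ?ych// => n tn; apply: no; exists n.
Qed.

(** * Functionals, domains and centers attached to trees *)

Definition functional t f : R :=
  if t is node ch d then d (fun r => f (decode ch r)) else 0.

Definition domain t x : Prop :=
  if t is node ch _ then supported ch x else x = 0.

Lemma functional_local t f g : (forall x, domain t x -> f x = g x) ->
  functional t f = functional t g.
Proof.
case: t => //= ch d fg; congr d; apply/funext => r.
exact/fg/decode_supported.
Qed.

Lemma domain0 t : domain t 0.
Proof. by case: t => // ch d; exact: supported0. Qed.

Lemma domain_child t x u : domain t x -> x u != 0 -> child u t.
Proof.
case: t => [->|ch d /= xch]; first by rewrite eqxx.
move=> xu; apply: contrapT => no; move/eqP: xu; apply; apply: xch => n un.
by apply: no; exists n.
Qed.

(** A point outside the domain has a nonzero coordinate at which every point of the domain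
    vanishes. *)
Lemma domain_closed t x : ~ domain t x ->
  exists2 e, 0 < e & forall y, domain t y -> e <= `|y - x|.
Proof.
move=> tx; have [u xu yu] : exists2 u, x u != 0 & forall y, domain t y -> y u = 0.
  case: t tx => [|ch d] /= tx.
    apply: contrapT => no; apply: tx; apply: bfeltP => u; apply/eqP.
    by apply: contrapT => /negP xu; apply: no; exists u => // y ->.
  apply: contrapT => no; apply: tx => u uch; apply/eqP; apply: contrapT => /negP xu.
  by apply: no; exists u => // y /(_ u uch).
exists `|x u|; first by rewrite normr_gt0.
by move=> y /yu yu0; apply: le_trans (bf_ub _ u); rewrite bfB yu0 sub0r normrN.
Qed.

Fact unit_vector_mem t : source_mem (fun u => (u == t)%:R).
Proof.
split; first by exists 1 => u; case: (u == t); rewrite ?normr1 ?normr0.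
by exists (fun=> t) => u /(_ 0%N)/eqP/negPf ->.
Qed.
Definition unit_vector t : X := BFElt (V := source_space) (unit_vector_mem t).

(* With this radius, correcting a 1-Lipschitz function bounded by 3/2 costs a
   slope of at most 16 * (N + 3) / radius t <= 1/2. *)
Definition radius t : R := 128 + 32 * xget 0 [set N | 0 <= N /\
  forall K f, 0 < K -> lip K f -> `|functional t f| <= N * K].

Definition center t : X := radius t *: unit_vector t.

Lemma radius_ge t : 128 <= radius t.
Proof.
rewrite /radius lerDl mulr_ge0//; case: xgetP => [N _ []//|_]; exact: lexx.
Qed.

Lemma centerE t u : center t u = if u == t then radius t else 0.
Proof. by rewrite /center bfZ /=; case: (u == t); rewrite ?mulr1 ?mulr0. Qed.

Lemma center_norm t : `|center t| = radius t.
Proof.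
have r0 : 0 <= radius t by apply: le_trans (radius_ge t).
apply/eqP; rewrite eq_le; apply/andP; split.
  by apply: bf_le => // u; rewrite centerE; case: ifP; rewrite ?normr0 ?ger0_norm.
by have := bf_ub (center t) t; rewrite centerE eqxx ger0_norm.
Qed.

Lemma center_far t x : x t = 0 -> radius t <= `|center t - x|.
Proof.
move=> xt; apply: le_trans (bf_ub _ t); rewrite bfB centerE eqxx xt subr0.
exact: ler_norm.
Qed.

Lemma center_sep t u : t <> u -> (radius t + radius u) / 2 <= `|center t - center u|.
Proof.
move=> tu; have /eqP/negPf tu' := tu; have /eqP/negPf ut := nesym tu.
have := @center_far t (center u); rewrite centerE tu' => /(_ erefl).
have := @center_far u (center t); rewrite centerE ut => /(_ erefl).
by rewrite distrC; lra.
Qed.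

Lemma domain_far t x : domain t x -> radius t <= `|center t - x|.
Proof.
move=> tx; apply: center_far; apply/eqP; apply: contrapT => /negP xt.
have tc := domain_child tx xt; exact: (child_asym tc tc).
Qed.

Lemma functional_bound t K f : lipfree (functional t) -> 0 < K -> lip K f ->
  `|functional t f| <= (radius t / 32 - 4) * K.
Proof.
move=> /lipfree_bound[N N0 NP] K0 fK; rewrite /radius.
have [] : [set N | 0 <= N /\ forall K f, 0 < K -> lip K f -> `|functional t f| <= N * K]
  (xget 0 [set N | 0 <= N /\ forall K f, 0 < K -> lip K f -> `|functional t f| <= N * K]).
  by apply: xgetPex; exists N.
move: (xget _ _) => L L0 /(_ K f K0 fK); rewrite (_ : _ - 4 = L)//; by field.
Qed.

(** Many trees name the same functional; the condition [code (functional t) = t] retains a single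
    one. *)
Definition code M : tree := xget leaf
  [set t | forall K f, 0 < K -> lip K f -> functional t f = M f].

(** * Good indices *)

Local Notation bsum := (bsum leaf center radius).
Local Notation nform := (normal_form leaf center radius functional).

(** [P] stands for the good children, which makes the recursion structural. Nothing is lost: at
    points supported on [ch] only spikes of children are alive. *)
Definition good_over (P : tree -> Prop) ch t : Prop :=
  [/\ lipfree (functional t), code (functional t) = t,
   forall w K, 0 <= K -> (forall u, P u -> `|w u| <= K * radius u) ->
     functional t (bsum P w) = 0 &
   ~ exists x, [/\ supported ch x, forall u, P u -> x <> center u &
       forall K f, 0 < K -> lip K f -> functional t f = nform P x f]].

(* The indices whose functionals are prescribed at the centers: those which are
   canonical, normalized, and not already the normal form of a non-center. *)
Fixpoint good t : Prop :=
  if t is node ch d then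
    good_over (fun u => exists2 n, u = ch n & good (ch n)) ch (node ch d)
  else False.

Local Notation spike := (spike center radius).

Lemma spike_coord t x : 0 < spike t x -> x t != 0.
Proof.
move=> /(spike_gt0P radius_ge) xt; apply/eqP => x0.
by have := center_far x0; rewrite distrC; have := radius_ge t; lra.
Qed.

Definition restricted (P : tree -> Prop) ch u := exists2 n, u = ch n & P (ch n).

(** A spike alive at [x] has its index in the support of [x] by [spike_coord], hence among the
    children. This turns the recursive conditions of [good] into global ones. *)
Lemma bsum_restricted P ch w x : supported ch x ->
  bsum (restricted P ch) w x = bsum P w x.
Proof.
move=> xch; have [[t [Pt tx ->]]|[x0 ->]] := bsumP leaf radius_ge center_sep P w x.
  apply: bsum_active => //; first exact: radius_ge; first exact: center_sep.
  have [n tn] : child t (node ch (fun=> 0)) by exact: domain_child (spike_coord tx).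
  by exists n; rewrite -?tn.
by apply: bsum_inactive => t [n -> Pn]; exact: x0.
Qed.

Lemma normal_form_restricted P ch x f : supported ch x ->
  nform (restricted P ch) x f = nform P x f.
Proof.
by move=> xch; rewrite /normal_form /correct !bsum_restricted//; exact: supported0.
Qed.

Lemma good_free t : good t -> lipfree (functional t).
Proof. by case: t => //= ch d []. Qed.

Lemma good_code t : good t -> code (functional t) = t.
Proof. by case: t => //= ch d []. Qed.

Lemma good_bsum t w K : good t -> 0 <= K ->
  (forall u, good u -> `|w u| <= K * radius u) -> functional t (bsum good w) = 0.
Proof.
case: t => //= ch d [_ _ kill _] K0 wK.
rewrite -(kill w K K0) => [|u [n -> gn]]; last exact: wK.
apply: (@functional_local (node ch d)) => x xch.
by rewrite -(@bsum_restricted _ ch).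
Qed.

Lemma good_not_normal_form t x : good t -> domain t x ->
  (forall u, good u -> x <> center u) ->
  ~ forall K f, 0 < K -> lip K f -> functional t f = nform good x f.
Proof.
case: t => [[]|ch d] [_ _ _ no] xch xc tx.
apply: no; exists x; split; first exact: xch.
  by move=> u [n -> gn]; exact: xc.
by move=> K f K0 fK; rewrite (normal_form_restricted _ _ xch); exact: tx K0 fK.
Qed.

Lemma code_eq M M' : (forall K f, 0 < K -> lip K f -> M f = M' f) -> code M = code M'.
Proof.
move=> MM'; congr (xget leaf _); apply/seteqP; split=> t /= tM K f K0 fK.
  by rewrite (tM K f K0 fK) (MM' K f K0 fK).
by rewrite (tM K f K0 fK) (MM' K f K0 fK).
Qed.

(** * Naming functionals by trees *)

Fact restriction_mem ch x :
  source_mem (fun t => if `[< exists n, t = ch n >] then x t else 0).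
Proof.
split; last by exists ch => t tch; case: asboolP => // -[n /tch].
by exists `|x| => t; case: asboolP => _; rewrite ?normr0// bf_ub.
Qed.
Definition restriction ch x : X := BFElt (V := source_space) (restriction_mem ch x).

Lemma restriction_supported ch x : supported ch (restriction ch x).
Proof. by move=> t tch /=; case: asboolP => // -[n /tch]. Qed.

Lemma restriction_id ch x : supported ch x -> restriction ch x = x.
Proof.
move=> xch; apply: bfeltP => t /=; case: asboolP => // no.
by rewrite xch// => n tn; apply: no; exists n.
Qed.

Lemma decode_restriction ch x : decode ch (x \o ch) = restriction ch x.
Proof.
rewrite -(decodeK (@restriction_supported ch x)); congr decode.
by apply/funext => n /=; case: asboolP => // -[]; exists n.
Qed.

Lemma restriction_lip ch x y : `|restriction ch x - restriction ch y| <= `|x - y|.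
Proof.
apply: bf_le => // t; rewrite bfB /=; case: asboolP => _.
  by rewrite -bfB bf_ub.
by rewrite subrr normr0.
Qed.

(** [M] is a limit of combinations involving countably many points in all. If [ch] enumerates all
    their coordinates, [M] does not distinguish [f] from [f] composed with the restriction to
    [ch]. *)
Lemma functional_node_onto M : lipfree M -> exists ch d,
  forall K f, 0 < K -> lip K f -> functional (node ch d) f = M f.
Proof.
move=> MF.
have /choice[s sM] : forall n : nat, exists s, forall K f, 0 < K -> lip K f ->
    `|M f - comb s f| <= n.+1%:R^-1 * K.
  by move=> n; apply: MF; rewrite invr_gt0 ltr0n.
pose point n i : X := (nth (0, 0) (s n) i).2.
have /choice[chs chsP] : forall n, exists ch, forall i, supported ch (point n i).
  move=> n; have /choice[chs chsP] : forall i, exists ch, supported ch (point n i).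
    by move=> i; have [_] := bffunP (point n i).
  have [ch chP] := enum_union chs; exists ch => i t tch; apply: chsP => j tj.
  by have [k] := chP i j; rewrite -tj => /tch.
have [ch chP] := enum_union chs.
have pch n i : supported ch (point n i).
  move=> t tch; apply: chsP => j tj.
  by have [k] := chP n j; rewrite -tj => /tch.
exists ch, (fun g => M (fun x => g (x \o ch))) => K f K0 fK /=.
rewrite (_ : (fun x => _) = fun x => f (restriction ch x)); last first.
  by apply/funext => x; rewrite decode_restriction.
have rK : lip K (fun x => f (restriction ch x)).
  by move=> x y; apply: le_trans (fK _ _) _; rewrite ler_pM2l// restriction_lip.
apply: (@eq_small _ _ _ (K + K)) => e e0.
have [n ne] := ltr_add_invr e0; rewrite add0r in ne.
have sr : comb (s n) (fun x => f (restriction ch x)) = comb (s n) f.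
  rewrite /comb; apply: eq_big_seq => p ps.
  rewrite (restriction_id (@supported0 ch)) restriction_id//.
  by rewrite -(nth_index (0, 0) ps); exact: pch.
have le : n.+1%:R^-1 * K <= e * K by rewrite ler_pM2r// ltW.
rewrite mulrDr; apply: le_trans (ler_distD (comb (s n) f) _ _) _; apply: lerD.
  by rewrite -{1}sr; apply: le_trans le; exact: sM.
by rewrite distrC; apply: le_trans le; exact: sM.
Qed.

(** * Bijectivity of the normal form on points *)

Lemma good_bound t K f : good t -> 0 < K -> lip K f ->
  `|functional t f| <= (radius t / 32 - 4) * K.
Proof. by move=> /good_free; exact: functional_bound. Qed.

Lemma good_center t f : good t -> nform good (center t) f = functional t f.
Proof.
by apply: normal_form_center; [exact: radius_ge|exact: center_norm|exact: center_sep].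
Qed.

Lemma normal_form_origin P f : nform P 0 f = 0.
Proof. by rewrite /normal_form subrr. Qed.

(** If [code M] is good, [M] is the normal form of its center. Otherwise only the last clause of
    [good_over] can fail, and that failure provides the point. *)
Lemma normal_form_onto M : lipfree M ->
  (forall w K, 0 <= K -> (forall u, good u -> `|w u| <= K * radius u) ->
    M (bsum good w) = 0) ->
  exists x, forall K f, 0 < K -> lip K f -> M f = nform good x f.
Proof.
move=> MF kill; have [ch0 [d0 Md0]] := functional_node_onto MF.
have Mcode : forall K f, 0 < K -> lip K f -> functional (code M) f = M f.
  apply: (@xgetPex _ leaf
    [set t | forall K f, 0 < K -> lip K f -> functional t f = M f]).
  by exists (node ch0 d0).
have codeE := code_eq Mcode.
have cF : lipfree (functional (code M)).
  apply: lipfree_limit => e e0; exists M => // K f K0 fK.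
  by rewrite (Mcode K f K0 fK) subrr normr0 mulr_ge0// ltW.
case E : (code M) Mcode codeE cF => [|ch d] Mcode codeE cF.
  by exists 0 => K f K0 fK; rewrite -(Mcode K f K0 fK) normal_form_origin.
have [g|ng] := pselect (good (node ch d)).
  exists (center (node ch d)) => K f K0 fK.
  by rewrite good_center// -(Mcode K f K0 fK).
apply: contrapT => no; apply: ng; split; [exact: cF|exact: codeE| |].
- move=> w K K0 wK.
  (* The bound on [w] is known only at good children; extension by 0 gives weights on all good
     indices. *)
  pose w' u := if `[< restricted good ch u >] then w u else 0.
  have w'K u : good u -> `|w' u| <= K * radius u.
    move=> gu; rewrite /w'; case: asboolP => [|_]; first exact: wK.
    by rewrite normr0 mulr_ge0// (le_trans _ (radius_ge u)).
  rewrite -(kill w' K K0 w'K).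
  (* [K + 1] because [Mcode] asks for a positive constant and [K] may be 0. *)
  have w'lip : lip (16 * (K + 1)) (bsum good w').
    apply: bsum_lip; [exact: radius_ge|exact: center_sep| |].
      by rewrite addr_ge0.
    move=> u /w'K; move/le_trans; apply; rewrite ler_wpM2r//.
      by rewrite (le_trans _ (radius_ge u)).
    by rewrite lerDl.
  rewrite -(Mcode _ _ _ w'lip); last by rewrite mulr_gt0// ltr_wpDl.
  apply: functional_local => x xch; rewrite -(@bsum_restricted good ch)//.
  have [[t [Pt tx ->]]|[x0 ->]] := bsumP leaf radius_ge center_sep (restricted good ch) w x.
    rewrite (bsum_active _ radius_ge center_sep _ Pt tx).
    by rewrite /w'; case: asboolP.
  by rewrite bsum_inactive.
- move=> [x [xch _ xM]]; apply: no; exists x => K f K0 fK.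
  by rewrite -(Mcode K f K0 fK) (xM K f K0 fK) normal_form_restricted.
Qed.

(** Two centers are told apart by [code], a center and a non-center by the last clause of
    [good_over] or by a tent. For two distinct non-centers that no tent separates, each lies in the
    domain of a spike alive at the other, and those two indices would be children of each other. *)
Lemma normal_form_inj x y :
  (forall K f, 0 < K -> lip K f -> nform good x f = nform good y f) ->
  x = y.
Proof.
have sep p q : p <> 0 -> (forall u, good u -> p <> center u) -> q <> p ->
    (forall u, good u -> 0 < spike u q -> ~ domain u p) ->
    ~ forall K f, 0 < K -> lip K f -> nform good p f = nform good q f.
  move=> p0 pc qp qdom pq.
  have [f fl] := normal_form_separates leaf radius_ge center_norm center_sep
    good_free functional_local domain_far domain_closed p0 pc qp qdom.
  by apply; exact: pq fl.
have cen t q : good t -> (forall u, good u -> q <> center u) ->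
    ~ forall K f, 0 < K -> lip K f -> nform good q f = nform good (center t) f.
  move=> gt qc qt; have [tq|ntq] := pselect (domain t q).
    apply: (good_not_normal_form gt tq qc) => K f K0 fK.
    by rewrite (qt K f K0 fK) good_center.
  apply: sep qt => //.
  - by move=> q0; apply: ntq; rewrite q0; exact: domain0.
  - by move=> e; apply: (qc t gt).
  - move=> u gu ut; rewrite (spike_disjoint radius_ge center_sep ut (j := t))//.
    by rewrite spike_center.
move=> xy; have yx K f K0 fK := esym (xy K f K0 fK).
have [[t [gt xt]]|xc] := pselect (exists t, good t /\ x = center t).
  have [[u [gu yu]]|yc] := pselect (exists t, good t /\ y = center t).
    rewrite xt yu -(good_code gt) -(good_code gu); congr center.
    apply: code_eq => K f K0 fK.
    by rewrite -(good_center f gt) -(good_center f gu) -xt -yu; exact: xy K0 fK.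
  exfalso; apply: (cen t y gt); last by rewrite -xt; exact: yx.
  by move=> u gu yu; apply: yc; exists u.
have xc' u : good u -> x <> center u by move=> gu xu; apply: xc; exists u.
have [[u [gu yu]]|yc] := pselect (exists t, good t /\ y = center t).
  by exfalso; apply: (cen u x gu xc'); rewrite -yu; exact: xy.
have yc' u : good u -> y <> center u by move=> gu yu; apply: yc; exists u.
apply: contrapT => nxy.
have half p q : p <> 0 -> q <> p -> (forall u, good u -> p <> center u) ->
    (forall K f, 0 < K -> lip K f -> nform good p f = nform good q f) ->
    exists u, 0 < spike u q /\ domain u p.
  move=> p0 qp pc pq; apply: contrapT => no; apply: (sep p q) => // u gu uq up.
  by apply: no; exists u.
have origin u : 0 < spike u 0 -> False.
  by rewrite (spike_origin radius_ge center_norm) ltxx.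
have [x0|x0] := pselect (x = 0).
  have y0 : y <> 0 by move=> y0; apply: nxy; rewrite x0 y0.
  by have [u []] := half y x y0 nxy yc' yx; rewrite x0 => /origin.
have [y0|y0] := pselect (y = 0).
  by have [u []] := half x y x0 (nesym nxy) xc' xy; rewrite y0 => /origin.
have [u [uy ux]] := half x y x0 (nesym nxy) xc' xy.
have [v [vx vy]] := half y x y0 nxy yc' yx.
exact: child_asym (domain_child ux (spike_coord vx)) (domain_child vy (spike_coord uy)).
Qed.

(** Otherwise there are no corrections and every element of the Lipschitz-free space would be an
    evaluation. Twice the evaluation at [a] is not: on the tent at [a] of radius the norm of [a] it
    exceeds every evaluation. *)
Lemma good_exists : exists t, good t.
Proof.
apply: contrapT => no; have none t : ~ good t by move=> gt; apply: no; exists t.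
have b0 w x : bsum good w x = 0 by apply: bsum_inactive => t /none.
pose a := center leaf; pose M (f : X -> R) := 1 * (f a - f 0) + (f a - f 0).
have [||x Mx] := @normal_form_onto M.
- by apply: lipfree_lin; exact: lipfree_eval.
- by move=> w K _ _; rewrite /M !b0 subrr mulr0 addr0.
have := Mx 1 _ ltr01 (@tent_lip _ _ a `|a|); rewrite /M /normal_form /correct !b0.
rewrite !addr0 subrr normr0 subr0 sub0r normrN subrr maxxx subr0 mul1r.
rewrite (max_idPr (normr_ge0 a)) subr0; have a0 : 128 <= `|a|.
  by rewrite center_norm radius_ge.
by have := normr_ge0 (x - a); case: (leP 0 (`|a| - `|x - a|)); lra.
Qed.

End Trees.

Theorem theorem1p1 (R : realType) :
  exists (X Y : completeNormedModType R) (U : X -> Y),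
    [/\ bijective U,
        (forall x p q : X, cball x (1 / 4) p -> cball x (1 / 4) q ->
           `|U p - U q| = `|p - q|) &
        (exists p q : X, `|U p - U q| <> `|p - q|)].
Proof.
pose U : bfelt (@source_space R) -> _ := eval_map (@center R) (@functional R) (@good R).
have inj : injective U.
  move=> p q pq; apply: normal_form_inj => K f.
  exact: (eval_map_inj radius_ge center_norm center_sep good_free good_bound
    good_bsum pq).
have surj : forall y, exists x, U x = y.
  exact: (eval_map_surj radius_ge center_norm center_sep good_free good_bound
    functional_local good_bsum normal_form_onto).
exists (bfelt source_space), (bfelt (target_space _ _ _)), U; split.
- by have /choice[g gU] := surj; exists g => // x; apply: inj; rewrite gU.
- move=> x p q xp xq.
  apply: (eval_map_short radius_ge center_norm center_sep good_free good_bound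
    functional_local good_bsum domain_far).
  (* Two radii 1/4 add up to the scale 1/2 of [eval_map_short]. *)
  have := ler_distD x p q; rewrite (distrC x q).
  by move: xp xq; rewrite /cball /=; lra.
- have [t gt] := @good_exists R; exists (center t), 0.
  have := eval_map_contracts radius_ge center_norm good_bound gt.
  by rewrite lt_neqAle => /andP[/eqP].
Qed.
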